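(* Let $N_{sw}\ge 1$, let $M_1,\ldots,M_{N_{sw}}\in\mathbb{R}^{n\times n}$, and let $D=\mathrm{diag}(B,Q_1,\ldots,Q_{N_{sw}})$ be block diagonal with symmetric positive-definite blocks $B,Q_1,\ldots,Q_{N_{sw}}\in\mathbb{R}^{n\times n}$. Let $L$ be the block lower bidiagonal matrix associated with the $M_j$, and let $\tilde{L}$ be the approximation of $L$ obtained by replacing every $M_j$ by $\tilde{M}_j$, where either $\tilde{M}_j=0$ for all $j=1,\ldots,N_{sw}$, or $\tilde{M}_j=I_n$ for all $j=1,\ldots,N_{sw}$ (see context). Let $$A_p=(\tilde{L}^{-1}D\tilde{L}^{-T})(L^TD^{-1}L).$$ Then $$\sigma(A_p)\subset\mathcal{B}\big(1,\ (1+\kappa_2(D))\rho+\kappa_2(D)\rho^2\big),$$ where $$\rho=\begin{cases}\displaystyle\max_{j=1,\ldots,N_{sw}}\sigma_{\max}(M_j)&\text{if }\tilde{M}_j=0\ (j=1,\ldots,N_{sw}),\\[2ex]\displaystyle\sqrt{\frac{(nN_{sw}+1)(nN_{sw}+2)}{2}}\,\Big[\max_{j=1,\ldots,N_{sw}}\sigma_{\max}(I_n-M_j)\Big]&\text{if }\tilde{M}_j=I_n\ (j=1,\ldots,N_{sw}).\end{cases}$$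
   Context: Given $M_1,\ldots,M_{N_{sw}}\in\mathbb{R}^{n\times n}$, $L$ is the $(N_{sw}+1)\times(N_{sw}+1)$ block matrix with $n\times n$ blocks $$L=\begin{pmatrix}I_n&&&&\\-M_1&I_n&&&\\&-M_2&I_n&&\\&&\ddots&\ddots&\\&&&-M_{N_{sw}}&I_n\end{pmatrix},$$ i.e. identity blocks on the diagonal, $-M_i$ in block position $(i+1,i)$, and zero blocks elsewhere. $\tilde{L}$ is the matrix of the same form with each $M_j$ replaced by $\tilde{M}_j$. $\sigma(M)$ is the spectrum (set of eigenvalues) of a matrix $M$, $\sigma_{\max}(M)$ is its largest singular value, $\|\cdot\|_2$ is the matrix norm induced by the Euclidean norm, $\kappa_2(D)=\|D\|_2\|D^{-1}\|_2$, $\mathcal{B}(a,r)$ is the closed ball of radius $r$ centered at $a$, $I_n$ is the $n\times n$ identity matrix, and $\tilde{L}^{-T}=(\tilde{L}^{-1})^T$. *)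

(* Defs.v *)
From mathcomp Require Import all_boot all_order all_algebra.
From mathcomp Require Import complex.
From mathcomp Require Import all_classical all_reals all_analysis.

Set Implicit Arguments.
Unset Strict Implicit.
Unset Printing Implicit Defensive.

Import Order.TTheory GRing.Theory Num.Theory.
Import numFieldNormedType.Exports.

Local Open Scope classical_set_scope.
Local Open Scope ring_scope.
Local Open Scope complex_scope.

Definition posdefmx (R : realType) (n : nat) (A : 'M[R]_n) : Prop :=
  A \is symmetricmx /\
  forall v : 'cV[R]_n, v != 0 -> 0 < (v^T *m A *m v) ord0 ord0.

(* The norm that MathComp-Analysis puts on matrices is the max norm, so the
   Euclidean norm and the operator norm it induces are defined separately. *)
Definition enorm (R : realType) (n : nat) (v : 'cV[R]_n) : R :=
  Num.sqrt (\sum_(i < n) v i ord0 ^+ 2).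

Definition norm2 (R : realType) (n : nat) (A : 'M[R]_n) : R :=
  sup [set enorm (A *m v) / enorm v | v in [set v : 'cV[R]_n | v != 0]].

Definition cond2 (R : realType) (n : nat) (A : 'M[R]_n) : R :=
  norm2 A * norm2 (invmx A).

Definition singular_values (R : realType) (n : nat) (A : 'M[R]_n) : set R :=
  [set Num.sqrt a | a in [set a : R | eigenvalue (A^T *m A) a]].

(* The set of singular values is finite, so this supremum is a maximum
   as soon as n > 0. *)
Definition sigma_max (R : realType) (n : nat) (A : 'M[R]_n) : R :=
  sup (singular_values A).

(* Complex eigenvalues of a real matrix. *)
Definition spectrum (R : realType) (n : nat) (A : 'M[R]_n) : set R[i] :=
  [set z : R[i] | eigenvalue (map_mx (real_complex R) A) z].

(* MathComp-Analysis' [closed_ball a r] is the closure of the open ball, hence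
   empty for r = 0; [closed_ball_] is the set of points at distance <= r. *)
Definition cball (R : realType) (a : R[i]) (r : R) : set R[i] :=
  closed_ball_ (fun z : R[i] => `|z|) a r%:C.

(* Blocks are numbered from 0 and [M j] stands for M_(j+1).  [unlift ord0 i] is
   [Some k] when i = k+1, and [None] when i = 0; block (k+1, k) is thus
   [- M k]. *)
Definition bidiag (R : realType) (n N : nat) (M : 'I_N -> 'M[R]_n) :
    'M[R]_(\sum_(i < N.+1) n) :=
  \mxblock_(i < N.+1, j < N.+1)
    (if i == j then 1%:M
     else if unlift ord0 i is Some k then
       if j == k :> nat then - M k else 0
     else 0).

(* diag(B, Q_1, ..., Q_N), with [Q j] standing for Q_(j+1). *)
Definition bdiag (R : realType) (n N : nat) (B : 'M[R]_n)
    (Q : 'I_N -> 'M[R]_n) : 'M[R]_(\sum_(i < N.+1) n) :=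
  \mxdiag_(i < N.+1) (if unlift ord0 i is Some k then Q k else B).

(* Main.v *)
(* Conjugation by [Lt] turns [Ap] into [D W^T D^-1 W], where [W = L Lt^-1 = 1 + E],
   so that [Ap] has the spectrum of [1 + F] with [F] a sum of three terms of norm
   at most [|E|], [cond2 D |E|] and [cond2 D |E|^2]; it remains to show [|E| <= rho],
   that is, [|(L - Lt) u| <= rho |Lt u|] for all [u].  The blocks of [(L - Lt) u] are
   [(Mt_k - M_k) u_k], and the norm of a matrix is its largest singular value.
   If [Mt = 0], then [Lt u = u].
   If [Mt = 1], then [Lt u] consists of the increments of [u], so
   [|u_k|^2 <= (k + 1) |Lt u|^2], and summing over [k < N] gives the factor
   [N (N + 1) / 2 <= (n N + 1) (n N + 2) / 2]. *)
Require Import Defs.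
From mathcomp Require Import all_boot all_order all_algebra.
From mathcomp Require Import complex.
From mathcomp Require Import all_classical all_reals all_analysis.
From mathcomp Require Import ring lra zify.
Import Order.TTheory GRing.Theory Num.Theory.
Import numFieldNormedType.Exports.
Local Open Scope classical_set_scope.
Local Open Scope ring_scope.
Local Open Scope complex_scope.

Set Implicit Arguments.
Unset Strict Implicit.

(** * Euclidean inner product and norm of column vectors *)

Definition dotv (R : realType) (n : nat) (x y : 'cV[R]_n) : R :=
  (x^T *m y) ord0 ord0.

(** Upper bounds on the induced norm, stated without the supremum: they pass to sums, products and
    transposes with no nonemptiness or boundedness to check. *)
Definition opbound (R : realType) (m n : nat) (A : 'M[R]_(m, n)) (c : R) :=
  forall x : 'cV[R]_n, enorm (A *m x) <= c * enorm x.

Lemma dotvC (R : realType) (n : nat) (x y : 'cV[R]_n) : dotv x y = dotv y x.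
Proof.
by rewrite /dotv -[in LHS](trmxK y) -trmx_mul mxE.
Qed.

Lemma dotvDr (R : realType) (n : nat) (x y z : 'cV[R]_n) :
  dotv x (y + z) = dotv x y + dotv x z.
Proof. by rewrite /dotv mulmxDr mxE. Qed.

Lemma dotvZr (R : realType) (n : nat) (a : R) (x y : 'cV[R]_n) :
  dotv x (a *: y) = a * dotv x y.
Proof. by rewrite /dotv -scalemxAr mxE. Qed.

Lemma dotvDl (R : realType) (n : nat) (x y z : 'cV[R]_n) :
  dotv (y + z) x = dotv y x + dotv z x.
Proof. by rewrite dotvC dotvDr !(dotvC x). Qed.

Lemma dotvZl (R : realType) (n : nat) (a : R) (x y : 'cV[R]_n) :
  dotv (a *: y) x = a * dotv y x.
Proof. by rewrite dotvC dotvZr dotvC. Qed.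

Lemma dotv_mull (R : realType) (m n : nat) (A : 'M[R]_(m, n)) x y :
  dotv (A *m x) y = dotv x (A^T *m y).
Proof. by rewrite /dotv trmx_mul mulmxA. Qed.

Lemma enorm_ge0 (R : realType) (n : nat) (x : 'cV[R]_n) : 0 <= enorm x.
Proof. exact: sqrtr_ge0. Qed.

Lemma enorm_sqr (R : realType) (n : nat) (x : 'cV[R]_n) :
  enorm x ^+ 2 = \sum_i x i ord0 ^+ 2.
Proof. by rewrite sqr_sqrtr // sumr_ge0 // => i _; rewrite sqr_ge0. Qed.

Lemma enorm_dotv (R : realType) (n : nat) (x : 'cV[R]_n) :
  enorm x ^+ 2 = dotv x x.
Proof. by rewrite enorm_sqr /dotv mxE; apply: eq_bigr => i _; rewrite mxE. Qed.

Lemma enorm_eq0 (R : realType) (n : nat) (x : 'cV[R]_n) :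
  (enorm x == 0) = (x == 0).
Proof.
rewrite -sqrf_eq0 enorm_sqr psumr_eq0; last by move=> i _; rewrite sqr_ge0.
apply/allP/eqP => [x0|-> i _]; last by rewrite /= mxE expr0n eqxx.
apply/matrixP => i j; rewrite (ord1 j) mxE.
by have /= := x0 i (mem_index_enum i); rewrite sqrf_eq0 => /eqP.
Qed.

Lemma enorm0 (R : realType) (n : nat) : enorm (0 : 'cV[R]_n) = 0.
Proof. by apply/eqP; rewrite enorm_eq0. Qed.

Lemma enorm_gt0 (R : realType) (n : nat) (x : 'cV[R]_n) :
  (0 < enorm x) = (x != 0).
Proof. by rewrite lt0r enorm_ge0 andbT enorm_eq0. Qed.

(** The quadratic form [<s x + t y, P (s x + t y)>] in [(s, t)] is nonnegative, so its discriminant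
    is at most zero. [P = 1] gives the usual inequality; [norm2_singular] takes
    [P = s^2 - A^T A]. *)
Lemma psd_cauchy (R : realType) (n : nat) (P : 'M[R]_n) :
    P^T = P -> (forall x, 0 <= dotv x (P *m x)) ->
  forall x y, dotv x (P *m y) ^+ 2 <= dotv x (P *m x) * dotv y (P *m y).
Proof.
move=> Psym Ppos x y.
have sym : dotv y (P *m x) = dotv x (P *m y).
  by rewrite dotvC dotv_mull Psym.
have pos s t : 0 <= s ^+ 2 * dotv x (P *m x) + s * t * dotv x (P *m y) *+ 2
    + t ^+ 2 * dotv y (P *m y).
  have := Ppos (s *: x + t *: y).
  rewrite mulmxDr -!scalemxAr !(dotvDl, dotvDr, dotvZl, dotvZr) sym.
  by congr (_ <= _); ring.
move: (dotv x (P *m x)) (dotv x (P *m y)) (dotv y (P *m y)) pos (Ppos x) (Ppos y).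
move=> a b c pos a0 c0.
move: c0; rewrite le0r => /orP[/eqP c0|c0].
  (* With [c = 0] this instance reads [- (a + 2) b^2 >= 0], which forces [b = 0]. *)
  have := pos b (- (a + 1)); rewrite c0 => h.
  by have := sqr_ge0 b; nra.
have := pos c (- b) => h.
have {}h : 0 <= c * (a * c - b ^+ 2) by lra.
by rewrite -subr_ge0 -(pmulr_rge0 _ c0).
Qed.

Lemma dotv_le_enorm (R : realType) (n : nat) (x y : 'cV[R]_n) :
  dotv x y <= enorm x * enorm y.
Proof.
have h : dotv x y ^+ 2 <= (enorm x * enorm y) ^+ 2.
  have pos z : 0 <= dotv z ((1%:M : 'M[R]_n) *m z).
    by rewrite mul1mx -enorm_dotv sqr_ge0.
  have := psd_cauchy (trmx1 _ _) pos x y.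
  by rewrite !mul1mx exprMn !enorm_dotv.
apply: le_trans (ler_norm _) _.
by rewrite -ler_sqr ?nnegrE ?mulr_ge0 ?enorm_ge0 // real_normK ?num_real.
Qed.

Lemma enormD (R : realType) (n : nat) (x y : 'cV[R]_n) :
  enorm (x + y) <= enorm x + enorm y.
Proof.
rewrite -ler_sqr ?nnegrE ?addr_ge0 ?enorm_ge0 //.
rewrite enorm_dotv !(dotvDl, dotvDr) (dotvC y x) sqrrD !enorm_dotv.
by have := dotv_le_enorm x y; lra.
Qed.

Lemma enormZ (R : realType) (n : nat) (a : R) (x : 'cV[R]_n) :
  enorm (a *: x) = `|a| * enorm x.
Proof.
apply/eqP; rewrite -(@eqrXn2 _ 2) ?mulr_ge0 ?enorm_ge0 ?normr_ge0 //.
by rewrite exprMn !enorm_dotv dotvZl dotvZr real_normK ?num_real // mulrA expr2.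
Qed.

(** * Bounds on the operator norm, and [norm2] *)

Lemma opboundN (R : realType) (m n : nat) (A : 'M[R]_(m, n)) (a : R) :
  opbound A a -> opbound (- A) a.
Proof. by move=> hA x; rewrite mulNmx -scaleN1r enormZ normrN1 mul1r. Qed.

Lemma opboundD (R : realType) (m n : nat) (A B : 'M[R]_(m, n)) (a b : R) :
  opbound A a -> opbound B b -> opbound (A + B) (a + b).
Proof.
move=> hA hB x; rewrite mulmxDl mulrDl.
exact: le_trans (enormD _ _) (lerD (hA x) (hB x)).
Qed.

Lemma opboundM (R : realType) (m n p : nat) (A : 'M[R]_(m, n)) (B : 'M[R]_(n, p))
    (a b : R) :
  0 <= a -> opbound A a -> opbound B b -> opbound (A *m B) (a * b).
Proof.
move=> a0 hA hB x; rewrite -mulmxA -mulrA.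
by apply: le_trans (hA _) _; apply: ler_wpM2l.
Qed.

(** [|A^T x|^2 = <x, A A^T x> <= |x| a |A^T x|]; then divide by [|A^T x|]. *)
Lemma opbound_tr (R : realType) (m n : nat) (A : 'M[R]_(m, n)) (a : R) :
  0 <= a -> opbound A a -> opbound A^T a.
Proof.
move=> a0 hA x.
have [-> |nz] := eqVneq (A^T *m x) 0; first by rewrite enorm0 mulr_ge0 ?enorm_ge0.
rewrite -(ler_pM2l (x := enorm (A^T *m x))) ?enorm_gt0 // -expr2 enorm_dotv.
rewrite dotv_mull trmxK; apply: le_trans (dotv_le_enorm _ _) _.
by have := ler_wpM2l (enorm_ge0 x) (hA (A^T *m x)); lra.
Qed.

(** The Frobenius norm is such a bound, by Cauchy-Schwarz in each row. It serves to show that the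
    suprema in [norm2] and [sigma_max] are over sets bounded above. *)
Lemma opbound_exists (R : realType) (m n : nat) (A : 'M[R]_(m, n)) :
  exists2 c, 0 <= c & opbound A c.
Proof.
pose c := \sum_i enorm (row i A)^T ^+ 2.
have c0 : 0 <= c by apply: sumr_ge0 => i _; rewrite sqr_ge0.
exists (Num.sqrt c); first exact: sqrtr_ge0.
move=> x; rewrite -ler_sqr ?nnegrE ?mulr_ge0 ?sqrtr_ge0 //.
rewrite enorm_sqr exprMn sqr_sqrtr // mulr_suml; apply: ler_sum => i _.
have -> : (A *m x) i ord0 = dotv (row i A)^T x.
  by rewrite /dotv trmxK -row_mul [RHS]mxE.
rewrite -exprMn -[leLHS]real_normK ?num_real // ler_sqr ?nnegrE ?mulr_ge0 ?enorm_ge0 //.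
rewrite ler_norml dotv_le_enorm andbT lerNl -mulN1r -dotvZr.
by apply: le_trans (dotv_le_enorm _ _) _; rewrite enormZ normrN1 mul1r.
Qed.

Lemma opbound_norm2 (R : realType) (n : nat) (A : 'M[R]_n) :
  opbound A (norm2 A).
Proof.
move=> x; have [->|nz] := eqVneq x 0; first by rewrite mulmx0 !enorm0 mulr0.
rewrite -ler_pdivrMr ?enorm_gt0 //.
have [c c0 hc] := opbound_exists A.
apply: (ub_le_sup
  (E := [set enorm (A *m v) / enorm v | v in [set v : 'cV[R]_n | v != 0]])).
  exists c => _ [v /= v0 <-]; by rewrite ler_pdivrMr ?enorm_gt0.
by exists x.
Qed.

Lemma norm2_ge0 (R : realType) (n : nat) (A : 'M[R]_n) : 0 <= norm2 A.
Proof.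
rewrite /norm2; set E := image _ _.
(* In dimension 0 there is no nonzero vector, and the supremum of the empty set is 0. *)
have [->|/set0P [r Er]] := eqVneq E set0; first by rewrite sup0.
have [c c0 hc] := opbound_exists A.
apply: (@le_trans _ _ r); first by case: Er => v _ <-; rewrite divr_ge0 ?enorm_ge0.
apply: (ub_le_sup (E := E)) => //.
by exists c => _ [v /= v0 <-]; rewrite ler_pdivrMr ?enorm_gt0.
Qed.

Lemma norm2_le (R : realType) (n : nat) (A : 'M[R]_n) (c : R) :
  0 <= c -> opbound A c -> norm2 A <= c.
Proof.
move=> c0 hc; rewrite /norm2; set E := image _ _.
have [->|/set0P E0] := eqVneq E set0; first by rewrite sup0.
apply: ge_sup => // _ [v /= v0 <-]; by rewrite ler_pdivrMr ?enorm_gt0.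
Qed.

(** * Eigenvectors, and [norm2] as a singular value *)

Lemma unitmx_ker (F : fieldType) (n : nat) (A : 'M[F]_n) :
  (forall x : 'cV[F]_n, A *m x = 0 -> x = 0) -> A \in unitmx.
Proof.
move=> h; rewrite -unitmx_tr -row_free_unit -kermx_eq0; apply/rowV0P => v /sub_kermxP.
move/(congr1 trmx); rewrite trmx_mul trmxK trmx0 => /h /(congr1 trmx).
by rewrite trmxK trmx0.
Qed.

(** [eigenvalue] provides a row eigenvector. Without a column one, [A - a] would have trivial
    kernel, hence be invertible, and could not annihilate that row. *)
Lemma eigenvalue_col (F : fieldType) (n : nat) (A : 'M[F]_n) (a : F) :
  eigenvalue A a -> exists2 x : 'cV[F]_n, A *m x = a *: x & x != 0.
Proof.
move=> /eigenvalueP [v va v0].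
apply: contrapT => h.
have : A - a%:M \in unitmx.
  apply: unitmx_ker => x; rewrite mulmxBl mul_scalar_mx => /eqP; rewrite subr_eq0 => /eqP Ax.
  by apply/eqP; apply: contrapT => /negP x0; apply: h; exists x.
move=> u; have : v *m (A - a%:M) = 0 by rewrite mulmxBr va mul_mx_scalar subrr.
move/(congr1 (mulmx^~ (invmx (A - a%:M)))); rewrite mulmxK // mul0mx => /eqP.
by rewrite (negbTE v0).
Qed.

Lemma eigenvalue_similar (F : fieldType) (n : nat) (A X P : 'M[F]_n) (a : F) :
  P \in unitmx -> P *m A = X *m P -> eigenvalue X a -> eigenvalue A a.
Proof.
move=> Pu PA /eigenvalueP [v va v0]; apply/eigenvalueP; exists (v *m P).
  by rewrite -mulmxA PA mulmxA va scalemxAl.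
apply: contraNneq v0 => /(congr1 (mulmx^~ (invmx P))).
by rewrite mulmxK // mul0mx => ->.
Qed.

(* If [P := s^2 - A^T A], with [s = norm2 A], were invertible, Cauchy-Schwarz
   for the form [P] would make it coercive, and [s] could be lowered. *)
Lemma norm2_singular (R : realType) (n : nat) (A : 'M[R]_n) (x : 'cV[R]_n) :
  x != 0 -> singular_values A (norm2 A).
Proof.
move=> x0; set s := norm2 A; have s0 : 0 <= s by exact: norm2_ge0.
exists (s ^+ 2); last by rewrite sqrtr_sqr ger0_norm.
rewrite /=; apply: contrapT => neig.
pose P := (s ^+ 2)%:M - A^T *m A.
have Psym : P^T = P by rewrite /P linearB /= tr_scalar_mx trmx_mul trmxK.
have PE y : dotv y (P *m y) = (s * enorm y) ^+ 2 - enorm (A *m y) ^+ 2.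
  rewrite /P mulmxBl mul_scalar_mx exprMn !enorm_dotv.
  by rewrite dotv_mull -mulmxA -dotvZr /dotv mulmxBr !mxE.
have Ppos y : 0 <= dotv y (P *m y).
  by rewrite PE subr_ge0 ler_sqr ?nnegrE ?mulr_ge0 ?enorm_ge0 //; exact: opbound_norm2.
have Pu : P \in unitmx.
  rewrite -row_free_unit -kermx_eq0; apply/rowV0P => v /sub_kermxP vP.
  apply/eqP; apply: contrapT => /negP v0; apply: neig; apply/eigenvalueP; exists v => //.
  by move/eqP: vP; rewrite mulmxBr mul_mx_scalar subr_eq0 eq_sym => /eqP.
have [p p0 hp] := opbound_exists P.
have [q q0 hq] := opbound_exists (invmx P).
have coer y : enorm y ^+ 2 <= q ^+ 2 * p * dotv y (P *m y).
  have h1 : enorm y <= q * enorm (P *m y).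
    by have := hq (P *m y); rewrite mulKmx.
  (* Cauchy-Schwarz for [P] at [P y] and [y]: [|P y|^4 <= <P y, P (P y)> <y, P y> <= p |P y|^2 <y, P
     y>]. *)
  have h2 : enorm (P *m y) ^+ 2 <= p * dotv y (P *m y).
    have [->|nz] := eqVneq (P *m y) 0.
      by rewrite enorm0 expr0n /= /dotv mulmx0 mxE mulr0.
    have z0 : 0 < enorm (P *m y) ^+ 2 by rewrite exprn_gt0 ?enorm_gt0.
    rewrite -(ler_pM2l z0).
    have := psd_cauchy Psym Ppos (P *m y) y.
    rewrite -enorm_dotv => /le_trans; apply.
    rewrite [leRHS]mulrCA mulrA ler_wpM2r // expr2 mulrA.
    apply: le_trans (dotv_le_enorm _ _) _.
    by rewrite mulrC ler_wpM2r ?enorm_ge0.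
  have h3 : enorm y ^+ 2 <= q ^+ 2 * enorm (P *m y) ^+ 2.
    by rewrite -exprMn ler_sqr ?nnegrE ?mulr_ge0 ?enorm_ge0.
  by apply: le_trans h3 _; rewrite -mulrA ler_wpM2l ?sqr_ge0.
set K := q ^+ 2 * p in coer.
have K0 : 0 < K.
  rewrite lt0r mulr_ge0 ?sqr_ge0 // andbT; apply: contraNneq x0 => K0.
  by have := coer x; rewrite K0 mul0r le_eqVlt ltNge sqr_ge0 orbF sqrf_eq0 enorm_eq0.
have AK y : enorm (A *m y) ^+ 2 <= (s ^+ 2 - K^-1) * enorm y ^+ 2.
  have := coer y; rewrite PE -ler_pdivrMl // exprMn; lra.
have sK : 0 <= s ^+ 2 - K^-1.
  have x2 : 0 < enorm x ^+ 2 by rewrite exprn_gt0 ?enorm_gt0.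
  by rewrite -(pmulr_lge0 _ x2); apply: le_trans (AK x); rewrite sqr_ge0.
have : s <= Num.sqrt (s ^+ 2 - K^-1).
  apply: norm2_le => [|y]; first exact: sqrtr_ge0.
  by rewrite -ler_sqr ?nnegrE ?mulr_ge0 ?sqrtr_ge0 ?enorm_ge0 // exprMn [X in X * _]sqr_sqrtr //.
rewrite -ler_sqr ?nnegrE ?sqrtr_ge0 // sqr_sqrtr //.
by rewrite lerBrDr gerDl leNgt invr_gt0 K0.
Qed.

(** [norm2 A] is a singular value, hence at most [sigma_max A] once the singular values are bounded:
    if [A^T A v = a v], then [a |v|^2 = |A v|^2 <= c^2 |v|^2]. *)
Lemma opbound_sigma_max (R : realType) (n : nat) (A : 'M[R]_n) :
  opbound A (sigma_max A).
Proof.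
move=> x; have [->|x0] := eqVneq x 0; first by rewrite mulmx0 !enorm0 mulr0.
apply: le_trans (opbound_norm2 A x) _; rewrite ler_wpM2r ?enorm_ge0 //.
have [c c0 hc] := opbound_exists A.
apply: (ub_le_sup (E := singular_values A)); last exact: norm2_singular x0.
exists c => _ [a /= /eigenvalue_col [v va v0] <-].
have v2 : 0 < enorm v ^+ 2 by rewrite exprn_gt0 ?enorm_gt0.
apply: le_trans (_ : Num.sqrt (c ^+ 2) <= c); last by rewrite sqrtr_sqr ger0_norm.
apply: ler_wsqrtr; rewrite -(ler_pM2r v2).
rewrite [in leLHS]enorm_dotv -dotvZr -va -mulmxA dotvC dotv_mull trmxK dotvC.
by rewrite -exprMn -enorm_dotv ler_sqr ?nnegrE ?mulr_ge0 ?enorm_ge0.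
Qed.

(** * Complex spectra of real matrices *)

(** An eigenvector of [F] for [z - 1 = p + i q] splits into real vectors with [F a = p a - q b] and
    [F b = q a + p b]. Then [|F a|^2 + |F b|^2 = (p^2 + q^2) (|a|^2 + |b|^2)], so the real bound on
    [F] suffices. *)
Lemma spectrum_opbound (R : realType) (n : nat) (F : 'M[R]_n) (c : R) :
  0 <= c -> opbound F c -> spectrum (1%:M + F) `<=` cball 1 c.
Proof.
move=> c0 hF z /= /eigenvalue_col [x]; rewrite map_mxD map_mx1 mulmxDl mul1mx.
move/eqP; rewrite addrC eq_sym -subr_eq -[X in _ - X]scale1r -scalerBl eq_sym => /eqP.
rewrite /cball /closed_ball_ /= distrC; move: (z - 1) => [p q] Fx x0.
pose a := map_mx (@complex.Re R) x; pose b := map_mx (@complex.Im R) x.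
(* [f] stands for the real or the imaginary part, which commutes with the action of the real matrix
   [F]. *)
have FE i (f : {additive R[i] -> R}) (hf : forall (r : R) (w : R[i]), f (r%:C * w) = r * f w) :
    f (((map_mx (real_complex R) F) *m x) i ord0) = (F *m map_mx f x) i ord0.
  rewrite !mxE raddf_sum; apply: eq_bigr => j _; by rewrite !mxE hf.
have Fa : F *m a = p *: a - q *: b.
  apply/matrixP => i j; rewrite (ord1 j) -(FE i (@complex.Re R)); last first.
    by move=> r [u v] /=; rewrite mul0r subr0.
  by rewrite Fx !mxE; case: (x i ord0).
have Fb : F *m b = q *: a + p *: b.
  apply/matrixP => i j; rewrite (ord1 j) -(FE i (@complex.Im R)); last first.
    by move=> r [u v] /=; rewrite mul0r addr0.
  by rewrite Fx !mxE; case: (x i ord0) => u v /=; rewrite addrC.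
rewrite normc_def /= lecR.
have ab : 0 < enorm a ^+ 2 + enorm b ^+ 2.
  rewrite lt0r addr_ge0 ?sqr_ge0 // andbT; apply: contraNneq x0 => /eqP.
  rewrite paddr_eq0 ?sqr_ge0 // !sqrf_eq0 !enorm_eq0 => /andP[/eqP a0 /eqP b0].
  apply/eqP/matrixP => i j; move/matrixP/(_ i j): a0; move/matrixP/(_ i j): b0.
  by rewrite !mxE; case: (x i j) => u v /= -> ->.
rewrite -[leRHS]ger0_norm // -sqrtr_sqr; apply: ler_wsqrtr.
rewrite -(ler_pM2r ab).
have -> : (p ^+ 2 + q ^+ 2) * (enorm a ^+ 2 + enorm b ^+ 2)
    = enorm (F *m a) ^+ 2 + enorm (F *m b) ^+ 2.
  rewrite Fa Fb -scaleNr !enorm_dotv !(dotvDl, dotvDr, dotvZl, dotvZr) (dotvC b a); ring.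
by rewrite mulrDr -!exprMn lerD // ler_sqr ?nnegrE ?mulr_ge0 ?enorm_ge0.
Qed.

Lemma spectrum_similar (R : realType) (n : nat) (A X P : 'M[R]_n) :
  P \in unitmx -> P *m A = X *m P -> spectrum A `<=` spectrum X.
Proof.
(* A row eigenvector [v] of [A] yields [v P^-1] for [X], so [eigenvalue_similar] is used with [A]
   and [X] exchanged and [P] inverted. *)
move=> Pu PA z; apply: (@eigenvalue_similar _ _ _ _ (map_mx (real_complex R) (invmx P))).
  by rewrite map_unitmx unitmx_inv.
by rewrite -!map_mxM; congr map_mx; rewrite -[LHS](mulmxK Pu) -(mulmxA _ X) -PA mulKmx.
Qed.

Lemma spectrum_tr (R : realType) (n : nat) (A : 'M[R]_n) :
  spectrum A `<=` spectrum A^T.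
Proof.
move=> z /= /eigenvalue_col [x xA x0]; apply/eigenvalueP; exists x^T.
  by rewrite -map_trmx -trmx_mul xA linearZ.
by rewrite -trmx0 (inj_eq trmx_inj).
Qed.

(** * Localization of the preconditioned spectrum *)

Lemma spectrum_precond (R : realType) (n : nat) (D L Lt : 'M[R]_n) (rho : R) :
    D^T = D -> D \in unitmx -> Lt \in unitmx -> 0 <= rho ->
    (forall u : 'cV[R]_n, enorm ((L - Lt) *m u) <= rho * enorm (Lt *m u)) ->
  spectrum ((invmx Lt *m D *m (invmx Lt)^T) *m (L^T *m invmx D *m L)) `<=`
    cball 1 ((1 + cond2 D) * rho + cond2 D * rho ^+ 2).
Proof.
move=> Dsym Du Ltu rho0 hL.
pose E := (L - Lt) *m invmx Lt.
have Erho : opbound E rho.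
  (* For [u = Lt^-1 x] the hypothesis reads [|E x| <= rho |x|]. *)
  by move=> x; rewrite -mulmxA (le_trans (hL _)) // mulKVmx.
have LE : L = (1%:M + E) *m Lt by rewrite mulmxDl mul1mx mulmxKV // addrC subrK.
(* [1 + F = (1 + E^T) (1 + D^-1 E D)] is the transpose of the conjugated matrix
   [D (1 + E)^T D^-1 (1 + E)]. Transposing keeps the spectrum and puts [D^-1] and [D] on the two
   sides of [E]. *)
pose F := E^T + invmx D *m (E *m D) + E^T *m (invmx D *m (E *m D)).
have Frho : opbound F ((1 + cond2 D) * rho + cond2 D * rho ^+ 2).
  have k0 := norm2_ge0 (invmx D).
  have Et := opbound_tr rho0 Erho.
  have D1 : opbound (invmx D *m (E *m D)) (norm2 (invmx D) * (rho * norm2 D)).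
    apply: opboundM => //; first exact: opbound_norm2.
    by apply: opboundM => //; exact: opbound_norm2.
  rewrite /cond2; set k := (_ + _); suff -> : k = rho + norm2 (invmx D) * (rho * norm2 D)
      + rho * (norm2 (invmx D) * (rho * norm2 D)).
    apply: opboundD; last exact: opboundM.
    exact: opboundD.
  by rewrite /k; ring.
apply: subset_trans; last apply: spectrum_opbound Frho; last first.
  by rewrite addr_ge0 ?mulr_ge0 ?addr_ge0 ?mulr_ge0 ?norm2_ge0 ?sqr_ge0.
have -> : 1%:M + F = ((D *m (1%:M + E)^T *m invmx D) *m (1%:M + E))^T.
  rewrite !trmx_mul trmxK trmx_inv Dsym [in RHS]linearD /= trmx1 /F.
  rewrite (mulmxDl 1%:M E D) mul1mx mulmxDr mulVmx //.
  by rewrite mulmxDr mulmx1 mulmxDl mul1mx !addrA.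
apply: subset_trans (@spectrum_tr _ _ _).
apply: (@spectrum_similar _ _ _ _ Lt) => //.
rewrite [in X in X = _]LE !trmx_mul trmx_inv !mulmxA mulmxV // mul1mx.
by rewrite -(mulmxA D) mulVmx ?unitmx_tr // mulmx1.
Qed.

(** * Block vectors, [bdiag] and [bidiag] *)

Lemma enorm_mxcol (R : realType) (n N : nat) (u : 'I_N -> 'cV[R]_n) :
  enorm (\mxcol_i u i) ^+ 2 = \sum_i enorm (u i) ^+ 2.
Proof.
rewrite enorm_dotv /dotv tr_mxcol mul_mxrow_mxcol summxE.
by apply: eq_bigr => i _; rewrite enorm_dotv.
Qed.

Lemma bdiag_mul (R : realType) (n N : nat) (B : 'M[R]_n) (Q : 'I_N -> 'M[R]_n)
    (u : 'I_N.+1 -> 'cV[R]_n) :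
  bdiag B Q *m (\mxcol_i u i)
    = \mxcol_i ((if unlift ord0 i is Some k then Q k else B) *m u i).
Proof. exact: mul_mxdiag_mxcol. Qed.

Lemma posdefmx_sym (R : realType) (n : nat) (A : 'M[R]_n) :
  posdefmx A -> A^T = A.
Proof.
by case=> /is_hermitianmxP; rewrite expr0 scale1r map_mx_id // => As _; rewrite -As.
Qed.

Lemma posdefmx_ker (R : realType) (n : nat) (A : 'M[R]_n) (x : 'cV[R]_n) :
  posdefmx A -> A *m x = 0 -> x = 0.
Proof.
move=> [_ Apos] Ax; apply/eqP; apply: contrapT => /negP /Apos.
by rewrite -mulmxA Ax mulmx0 mxE ltxx.
Qed.

Lemma bdiag_sym (R : realType) (n N : nat) (B : 'M[R]_n) (Q : 'I_N -> 'M[R]_n) :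
  posdefmx B -> (forall j, posdefmx (Q j)) -> (bdiag B Q)^T = bdiag B Q.
Proof.
move=> hB hQ; rewrite /bdiag tr_mxdiag; apply: eq_mxdiag => i.
by case: unliftP => [k|] _; exact: posdefmx_sym.
Qed.

Lemma bdiag_unit (R : realType) (n N : nat) (B : 'M[R]_n) (Q : 'I_N -> 'M[R]_n) :
  posdefmx B -> (forall j, posdefmx (Q j)) -> bdiag B Q \in unitmx.
Proof.
move=> hB hQ; apply: unitmx_ker => x; rewrite -[x]submxcolK bdiag_mul -mxcol0.
move/eq_mxcolP => x0; apply/eq_mxcolP => i; move: (x0 i).
by case: unliftP => [k|] _; exact: posdefmx_ker.
Qed.

Lemma bidiag_mul (R : realType) (n N : nat) (M : 'I_N -> 'M[R]_n)
    (u : 'I_N.+1 -> 'cV[R]_n) :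
  bidiag M *m (\mxcol_i u i)
    = \mxcol_i (if unlift ord0 i is Some k
                then u i - M k *m u (widen_ord (leqnSn N) k) else u i).
Proof.
rewrite /bidiag mul_mxblock_mxrow; apply: eq_mxcol => i.
rewrite (bigD1 i) //= eqxx mul1mx.
case: unliftP => [k ->|->]; last first.
  by rewrite big1 ?addr0 // => j /negbTE; rewrite eq_sym => ->; rewrite mul0mx.
(* Off the diagonal, block row [k + 1] can be nonzero only in block column [k], whose index in
   ['I_N.+1] is [widen_ord (leqnSn N) k]. *)
have kl : widen_ord (leqnSn N) k != lift ord0 k.
  by rewrite -val_eqE /= /bump /= neq_ltn ltnSn.
rewrite (bigD1 (widen_ord (leqnSn N) k)) //= eq_sym (negbTE kl) eqxx mulNmx.
rewrite big1 ?addr0 // => j /andP[/negbTE jl /negbTE jw].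
rewrite eq_sym jl; case: eqP => [jk|]; last by rewrite mul0mx.
by move: jw; rewrite -val_eqE /= jk eqxx.
Qed.

(** Forward substitution: on the kernel, block row 0 gives [x_0 = 0] and block row [i + 1] gives
    [x_(i+1) = M_i x_i]. *)
Lemma bidiag_unit (R : realType) (n N : nat) (M : 'I_N -> 'M[R]_n) :
  bidiag M \in unitmx.
Proof.
apply: unitmx_ker => x; rewrite -[x]submxcolK bidiag_mul -mxcol0.
move/eq_mxcolP => x0; apply/eq_mxcolP => -[i iN].
elim: i iN => [|i IHi] iN; have := x0 (Ordinal iN).
  by case: unliftP => // k /(congr1 val).
case: unliftP => [k /(congr1 val) [ik]|/(congr1 val)//].
suff -> : widen_ord (leqnSn N) k = Ordinal (ltnW iN) by rewrite IHi mulmx0 subr0.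
by apply: val_inj => /=; rewrite ik.
Qed.

Lemma enorm_bidiag (R : realType) (n N : nat) (M : 'I_N -> 'M[R]_n)
    (u : 'I_N.+1 -> 'cV[R]_n) :
  enorm (bidiag M *m (\mxcol_i u i)) ^+ 2 = enorm (u ord0) ^+ 2
    + \sum_k enorm (u (lift ord0 k) - M k *m u (widen_ord (leqnSn N) k)) ^+ 2.
Proof.
rewrite bidiag_mul enorm_mxcol big_ord_recl unlift_none; congr (_ + _).
by apply: eq_bigr => k _; rewrite liftK.
Qed.

(** The identity blocks cancel in the difference, so block row 0 vanishes and the last block of [u]
    does not enter. *)
Lemma enorm_bidiagB (R : realType) (n N : nat) (M Mt : 'I_N -> 'M[R]_n) (s : R)
    (u : 'I_N.+1 -> 'cV[R]_n) :
    0 <= s -> (forall k, opbound (Mt k - M k) s) ->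
  enorm ((bidiag M - bidiag Mt) *m (\mxcol_i u i)) ^+ 2
    <= s ^+ 2 * \sum_k enorm (u (widen_ord (leqnSn N) k)) ^+ 2.
Proof.
move=> s0 hs; rewrite mulmxBl !bidiag_mul -mxcolB enorm_mxcol big_ord_recl.
rewrite unlift_none subrr enorm0 expr0n add0r mulr_sumr; apply: ler_sum => k _.
rewrite liftK opprB addrC subrKA -mulmxBl -exprMn.
rewrite ler_sqr ?nnegrE ?mulr_ge0 ?enorm_ge0 //; exact: hs.
Qed.

(** * Estimates of a block vector by its bidiagonal image *)

(** [u i] is a sum of [i + 1] vectors, [u 0] and the increments: this is Cauchy-Schwarz for that
    sum, obtained by induction. *)
Lemma enorm_telescope (R : realType) (n : nat) (u : nat -> 'cV[R]_n) (i : nat) :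
  enorm (u i) ^+ 2
    <= i.+1%:R * (enorm (u 0%N) ^+ 2 + \sum_(j < i) enorm (u j.+1 - u j) ^+ 2).
Proof.
elim: i => [|i IHi]; first by rewrite big_ord0 addr0 mul1r.
rewrite big_ord_recr /= addrA; set S := enorm (u 0%N) ^+ 2 + _ in IHi *.
have k0 : 0 < i.+1%:R :> R by rewrite ltr0n.
have := enormD (u i.+1 - u i) (u i); rewrite subrK.
rewrite -[i.+2%:R]natr1.
move: (enorm_ge0 (u i.+1)) (enorm_ge0 (u i)) (enorm_ge0 (u i.+1 - u i)).
move: IHi k0; move: (enorm (u i.+1)) (enorm (u i)) (enorm (u i.+1 - u i)).
move: (i.+1%:R : R) => k c a b IHi k0 c0 a0 b0 cab.
have c2 : c ^+ 2 <= (b + a) ^+ 2 by rewrite ler_sqr ?nnegrE ?addr_ge0.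
(* With [k = i + 1], the gap multiplied by [k] equals [(k + 1) (k S - a^2) + (a - k b)^2]. *)
apply: le_trans c2 _; rewrite -subr_ge0 -(pmulr_rge0 _ k0).
(* AM-GM: [2 k a b <= a^2 + k^2 b^2] *)
have := sqr_ge0 (a - k * b).
have : 0 <= (k + 1) * (k * S - a ^+ 2).
  by rewrite mulr_ge0 ?subr_ge0 ?addr_ge0 // ltW.
lra.
Qed.

Lemma sum_natS (R : realType) (N : nat) :
  \sum_(k < N) k.+1%:R = (N%:R * N.+1%:R) / 2%:R :> R.
Proof.
elim: N => [|N IHN]; first by rewrite big_ord0 !mul0r.
by rewrite big_ord_recr /= IHN -!natr1; field.
Qed.

Lemma enorm_bidiag1 (R : realType) (n N : nat) (M : 'I_N -> 'M[R]_n)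
    (u : 'I_N.+1 -> 'cV[R]_n) :
    (forall k, M k = 1%:M) ->
  \sum_k enorm (u (widen_ord (leqnSn N) k)) ^+ 2
    <= (N%:R * N.+1%:R) / 2%:R * enorm (bidiag M *m (\mxcol_i u i)) ^+ 2.
Proof.
move=> hM; rewrite enorm_bidiag -sum_natS mulr_suml; apply: ler_sum => k _.
(* [inord] extends [u] to all naturals, as [enorm_telescope] requires; only indices up to [N]
   occur. *)
pose v (j : nat) := u (inord j).
have vE i : v (val i) = u i by rewrite /v inord_val.
rewrite -(vE (widen_ord (leqnSn N) k)).
apply: le_trans (enorm_telescope v k) _; rewrite ler_wpM2l //.
rewrite (vE ord0) lerD2l.
(* The increments from index [k] on are added, their squares being nonnegative; this completes the
   sum to the full norm of the bidiagonal image. *)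
rewrite (big_ord_widen N (fun j => enorm (v j.+1 - v j) ^+ 2)) 1?ltnW //.
rewrite big_mkcond /=; apply: ler_sum => j _; case: ifP => _; last exact: sqr_ge0.
by rewrite hM mul1mx -(vE (lift ord0 j)) -(vE (widen_ord (leqnSn N) j)).
Qed.

(** Here [bidiag M] is the identity, and the left side omits only the last block. *)
Lemma enorm_bidiag0 (R : realType) (n N : nat) (M : 'I_N -> 'M[R]_n)
    (u : 'I_N.+1 -> 'cV[R]_n) :
    (forall k, M k = 0) ->
  \sum_k enorm (u (widen_ord (leqnSn N) k)) ^+ 2
    <= enorm (bidiag M *m (\mxcol_i u i)) ^+ 2.
Proof.
move=> hM; rewrite enorm_bidiag.
under [X in _ <= _ + X]eq_bigr do rewrite hM mul0mx subr0.
by rewrite -(big_ord_recl N (fun i => enorm (u i) ^+ 2)) big_ord_recr /= lerDl sqr_ge0.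
Qed.

(** * Assembly for the two choices of [Mt] *)

Unset Implicit Arguments.

Theorem corollary4p2 (R : realType) (n N : nat) (hN : (1 <= N)%N)
    (M : 'I_N -> 'M[R]_n) (B : 'M[R]_n) (Q : 'I_N -> 'M[R]_n)
    (hB : posdefmx B) (hQ : forall j, posdefmx (Q j))
    (Mt : 'I_N -> 'M[R]_n) (rho : R)
    (hMt :
      ((forall j, Mt j = 0) /\
       rho = \big[Num.max/0]_(j < N) sigma_max (M j))
      \/
      ((forall j, Mt j = 1%:M) /\
       rho = Num.sqrt (((n * N + 1)%:R * (n * N + 2)%:R) / 2%:R)
             * \big[Num.max/0]_(j < N) sigma_max (1%:M - M j))) :
  let D := bdiag B Q in
  let L := bidiag M in
  let Lt := bidiag Mt in
  let Ap := (invmx Lt *m D *m (invmx Lt)^T) *m (L^T *m invmx D *m L) in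
  spectrum Ap `<=`
    cball 1 ((1 + cond2 D) * rho + cond2 D * rho ^+ 2).
Proof.
move=> D L Lt Ap.
have bigmax_sigma (A : 'I_N -> 'M[R]_n) :
    let s := \big[Num.max/0]_(j < N) sigma_max (A j) in
    0 <= s /\ forall k, opbound (A k) s.
  split=> [|k x]; first exact: bigmax_ge_id.
  apply: le_trans (opbound_sigma_max (A k) x) _; rewrite ler_wpM2r ?enorm_ge0 //.
  exact: (le_bigmax _ (fun j => sigma_max (A j))).
suff [rho0 hrho] : 0 <= rho /\
    forall u : 'cV[R]_(\sum_(i < N.+1) n), enorm ((L - Lt) *m u) <= rho * enorm (Lt *m u).
  apply: spectrum_precond => //; [exact: bdiag_sym | exact: bdiag_unit | exact: bidiag_unit].
case: hMt => -[hMt ->]; [have [s0 hs] := bigmax_sigma M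
                       | have [s0 hs] := bigmax_sigma (fun j => 1%:M - M j)].
all: move: (\big[_/_]_(_ < _) _) s0 hs => s s0 hs.
  split=> // u; rewrite -[u]submxcolK.
  rewrite -ler_sqr ?nnegrE ?mulr_ge0 ?enorm_ge0 // exprMn.
  apply: le_trans (enorm_bidiagB (s := s) _ s0 _) _.
    by move=> k; rewrite hMt sub0r; exact: opboundN.
  by rewrite ler_wpM2l ?sqr_ge0 // enorm_bidiag0.
split=> [|u]; first by rewrite mulr_ge0 ?sqrtr_ge0.
rewrite -[u]submxcolK -ler_sqr ?nnegrE ?mulr_ge0 ?sqrtr_ge0 ?enorm_ge0 //.
apply: le_trans (enorm_bidiagB (s := s) _ s0 _) _; first by move=> k; rewrite hMt.
rewrite 2!exprMn [X in X * _ * _]sqr_sqrtr ?mulr_ge0 ?invr_ge0 //.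
rewrite -[leRHS]mulrA [leRHS]mulrCA ler_wpM2l ?sqr_ge0 //.
(* [n = 0] is separate because [(n N + 1) (n N + 2) / 2] is then 1, which is below [N (N + 1) / 2]
   when [N >= 2]; the blocks are then empty and their norms vanish. *)
case: n => [|m] in M B Q hB hQ Mt hMt D L Lt Ap bigmax_sigma hs u *.
  rewrite big1 => [|k _]; last by rewrite enorm_sqr big_ord0.
  by apply: mulr_ge0; rewrite ?sqr_ge0 // divr_ge0 // mulr_ge0.
apply: le_trans (enorm_bidiag1 _ hMt) _.
(* For [n = m + 1], [N <= n N + 1] and [N + 1 <= n N + 2], so the sharper factor is at most the
   stated one. *)
rewrite ler_wpM2r ?sqr_ge0 // ler_wpM2r ?invr_ge0 // -!natrM ler_nat.
by rewrite leq_mul // mulSn; lia.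
Qed.
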